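(* Let $\ell\in G(2,1)$ and $0<\alpha<1$. Then for every $1<s<t<2$ there is a measure $\mu$ on $\mathbb{R}^2$ such that, for $\mu$-almost all $x\in\mathbb{R}^2$, $\underline{\dim}_{\mathrm{loc}}(\mu,x)=s$ and $$\limsup_{r\downarrow 0}\frac{\log\mu\bigl(B(x,r)\cap X(x,\ell,\alpha)\bigr)}{\log r}=s\,\frac{t-1}{s-1}>t=\overline{\dim}_{\mathrm{loc}}(\mu,x).$$
   Context: A measure on $\mathbb{R}^2$ means a nontrivial Borel regular outer measure defined on all subsets of $\mathbb{R}^2$ such that bounded sets have finite measure. $B(x,r)$ is the closed ball with centre $x$ and radius $r>0$. $G(2,1)$ is the space of all lines through the origin in $\mathbb{R}^2$. For $x\in\mathbb{R}^2$, $\ell\in G(2,1)$ and $0\le\alpha\le 1$, $X(x,\ell,\alpha)=\{y\in\mathbb{R}^2:\operatorname{dist}(y-x,\ell)<\alpha|y-x|\}$. The upper and lower local dimensions of $\mu$ at $x$ are $\overline{\dim}_{\mathrm{loc}}(\mu,x)=\limsup_{r\downarrow 0}\frac{\log\mu(B(x,r))}{\log r}$ and $\underline{\dim}_{\mathrm{loc}}(\mu,x)=\liminf_{r\downarrow 0}\frac{\log\mu(B(x,r))}{\log r}$. Convention: $\log 0=-\infty$, so $\log 0/\log r=+\infty$ for $0<r<1$. *)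

(* Defs.v *)
From HB Require Import structures.
From mathcomp Require Import all_boot all_order all_algebra.
From mathcomp Require Import all_classical all_reals all_analysis.

Set Implicit Arguments.
Unset Strict Implicit.
Unset Printing Implicit Defensive.

Import Order.TTheory GRing.Theory Num.Theory.
Import numFieldNormedType.Exports.

Local Open Scope classical_set_scope.
Local Open Scope ring_scope.

Section Plane.
Context {R : realType}.

(* The library's norm on matrices is the max norm; it induces the same topology
   and the same bounded sets, but balls, cones and distances to lines have to
   be taken with respect to the Euclidean norm. *)
Definition enorm (x : 'rV[R]_2) : R := Num.sqrt (\sum_(i < 2) x ord0 i ^+ 2).

Definition eball (x : 'rV[R]_2) (r : R) : set 'rV[R]_2 :=
  [set y | enorm (y - x) <= r].

Definition edist_to (x : 'rV[R]_2) (A : set 'rV[R]_2) : R :=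
  inf [set enorm (x - z) | z in A].

(* G(2,1) is the set of the l : {vspace 'rV[R]_2} such that \dim l = 1. *)
Definition cone (x : 'rV[R]_2) (l : {vspace 'rV[R]_2}) (alpha : R) :
    set 'rV[R]_2 :=
  [set y | edist_to (y - x) [set` l] < alpha * enorm (y - x)].

Definition borel : set (set 'rV[R]_2) := <<s open >>.

Definition borel_regular (mu : set 'rV[R]_2 -> \bar R) : Prop :=
  borel `<=` mu.-caratheodory /\
  forall A, exists B, [/\ borel B, A `<=` B & mu B = mu A].

(* The library's {ae mu, _} needs a measurable structure on the carrier; for an
   outer measure, the exceptional set just has to have outer measure zero. *)
Definition outer_ae (mu : set 'rV[R]_2 -> \bar R) (P : 'rV[R]_2 -> Prop) :
  Prop := mu [set x | ~ P x] = 0%E.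

Definition measure_on_plane (mu : {outer_measure set 'rV[R]_2 -> \bar R}) :
    Prop :=
  [/\ mu setT != 0%E,
      borel_regular mu &
      forall A, bounded_set A -> (mu A < +oo)%E].

(* lne 0 = -oo, hence the quotient is +oo when 0 < r < 1 and m r = 0. *)
Definition log_ratio (m : R -> \bar R) (r : R) : \bar R :=
  (lne (m r) / (ln r)%:E)%E.

Definition upper_dim_loc (mu : set 'rV[R]_2 -> \bar R) (x : 'rV[R]_2) :
    \bar R :=
  limf_esup (log_ratio (fun r => mu (eball x r))) 0^'+.

Definition lower_dim_loc (mu : set 'rV[R]_2 -> \bar R) (x : 'rV[R]_2) :
    \bar R :=
  limf_einf (log_ratio (fun r => mu (eball x r))) 0^'+.

End Plane.

(* Main.v *)
Require Import Defs.
From HB Require Import structures.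
From mathcomp Require Import all_boot all_order all_algebra.
From mathcomp Require Import all_classical all_reals all_analysis.
From mathcomp Require Import ring lra zify.

Set Implicit Arguments.
Unset Strict Implicit.
Unset Printing Implicit Defensive.

Import Order.TTheory GRing.Theory Num.Theory.
Import numFieldNormedType.Exports.

Local Open Scope classical_set_scope.
Local Open Scope ring_scope.

(** Coordinates are taken along l and across it (orthogonally to it). Put
p = s - 1 and q = t - 1, so that 0 < p < q < 1. The measure is a product:
Lebesgue measure across l times a Cantor-like measure nu along l. The support
of nu consists of the reals whose binary digits at certain levels are free and
at all the other levels are 0; nu gives equal mass to all the choices of free
digits. If d k is the number of free levels below k, then a dyadic interval of
length 2^-k that meets the support has nu-mass about 2^-(d k). The across
direction contributes a factor 2^-k, hence a ball of radius 2^-k centred in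
the support has mass comparable with 2^-(k + d k) ([mu_ball_le],
[mu_ball_ge]). The local dimensions are therefore the lower and upper limits
of 1 + d k / k.

The free levels come in runs, chosen by hysteresis: a run goes on until
d k >= q k, and the next one starts as soon as d k <= p k. This makes d k / k
oscillate between p and q exactly, whence the values s and t.

A cone around l forces the across displacement to be at most a constant times
the along displacement. At scale 2^-k, let j >= k be the next free level.
No point of the support lies at along distance between about 2^-j and 2^-k
from the centre, so the part of the ball that lies in the cone is contained in
a square of side about 2^-j, of mass 2^-(j + d k) ([mu_cone_le]); conversely
changing the free digit at level j produces a cell of comparable mass inside
the cone ([mu_cone_ge]). Thus the conical exponent is the upper limit of
(j + d k) / k. It is attained at the beginnings of the gaps, where d k is
about q k and the gap ends at the level j with p j about d k, and so equals
q / p + q = s (t - 1) / (s - 1) ([long_gap], [next_free_le]).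

All of this is proved for every point of the closed set of points whose along
coordinate lies in the closure of the admissible expansions; its complement is
an open null set. The measure nu itself is obtained as the image of Lebesgue
measure under the map [expansion], which sends a real to the one whose free
digits are its successive binary digits, and the outer measure is the Borel
regular one generated by the image of the Lebesgue measure of the plane. *)

(** * Lower and upper limits of logarithmic ratios *)

Section LogRatio.
Context {R : realType}.
Implicit Types (m f : R -> \bar R) (A C D r : R).

Lemma limf_esup_le f D :
  (forall eps, 0 < eps -> exists2 d, 0 < d &
     forall r, 0 < r < d -> (f r <= (D + eps)%:E)%E) ->
  (limf_esup f 0^'+ <= D%:E)%E.
Proof.
move=> h; apply/lee_addgt0Pr => eps /h[d d0 fd].
apply: (@le_trans _ _ (ereal_sup (f @` [set r | 0 < r < d]))).
  apply: ereal_inf_lbound; exists [set r | 0 < r < d] => //.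
  by near=> r; rewrite /=; apply/andP; split; near: r;
    [exact: nbhs_right_gt|exact: nbhs_right_lt].
by apply: ge_ereal_sup => _ [r /= rd <-]; rewrite -EFinD fd.
Unshelve. all: by end_near. Qed.

Lemma limf_esup_ge f D :
  (forall eps d, 0 < eps -> 0 < d ->
     exists2 r, 0 < r < d & ((D - eps)%:E <= f r)%E) ->
  (D%:E <= limf_esup f 0^'+)%E.
Proof.
move=> h; apply: le_ereal_inf_tmp => _ [V V0 <-].
apply/lee_subgt0Pr => eps eps0.
have [d /= d0 dV] : nbhs (0 : R) [set r | 0 < r -> V r] by exact: V0.
have [r /andP[r0 rd] fr] := h _ _ eps0 d0.
rewrite -EFinB; apply: (le_trans fr); apply: ereal_sup_ubound; exists r => //.
by apply: dV => //=; rewrite sub0r normrN gtr0_norm.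
Qed.

Lemma limf_einf_ge f D :
  (forall eps, 0 < eps -> exists2 d, 0 < d &
     forall r, 0 < r < d -> ((D - eps)%:E <= f r)%E) ->
  (D%:E <= limf_einf f 0^'+)%E.
Proof.
move=> h; rewrite /limf_einf leeNr -EFinN; apply: limf_esup_le => eps /h[d d0 fd].
by exists d => // r /fd; rewrite leeNl -EFinN opprD !opprK.
Qed.

Lemma limf_einf_le f D :
  (forall eps d, 0 < eps -> 0 < d ->
     exists2 r, 0 < r < d & (f r <= (D + eps)%:E)%E) ->
  (limf_einf f 0^'+ <= D%:E)%E.
Proof.
move=> h; rewrite /limf_einf leeNl -EFinN.
apply: limf_esup_ge => eps d /h /[apply] -[r rd fr].
by exists r => //=; rewrite leeNr -EFinN opprB opprK addrC.
Qed.

(** The inequality reverses because ln r is negative. *)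
Lemma log_ratio_le m A r : 0 < r < 1 ->
  ((expR (A * ln r))%:E <= m r)%E -> (log_ratio m r <= A%:E)%E.
Proof.
move=> /andP[r0 r1] h; rewrite /log_ratio.
have l0 : ln r < 0 by rewrite ln_lt0 ?r0.
have h1 : ((A * ln r)%:E <= lne (m r))%E.
  rewrite -(expRK (A * ln r)) -lne_EFin ?expR_gt0//.
  rewrite lee_lne// in_itv/= leey andbT ?lee_fin ?expR_ge0//.
  by rewrite (le_trans _ h)// lee_fin expR_ge0.
rewrite inver lt_eqF// -[X in (_ <= X%:E)%E](mulfK (ltr0_neq0 l0)) EFinM.
by rewrite -leeN2 -!muleN -EFinN lee_wpmul2r// lee_fin oppr_ge0 invr_le0 ltW.
Qed.

Lemma log_ratio_ge m A r : 0 < r < 1 ->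
  (m r <= (expR (A * ln r))%:E)%E -> (A%:E <= log_ratio m r)%E.
Proof.
move=> /andP[r0 r1] h; rewrite /log_ratio.
have l0 : ln r < 0 by rewrite ln_lt0 ?r0.
have h1 : (lne (m r) <= (A * ln r)%:E)%E.
  have [m0|m0] := leP (m r) 0%E; first by rewrite le0_lneNy// leNye.
  rewrite -[X in (_ <= X%:E)%E]expRK -lne_EFin ?expR_gt0//.
  by rewrite lee_lne// in_itv/= leey andbT ?lee_fin ?expR_ge0// ltW.
rewrite inver lt_eqF// -[X in (X%:E <= _)%E](mulfK (ltr0_neq0 l0)) EFinM.
by rewrite -leeN2 -!muleN -EFinN lee_wpmul2r// lee_fin oppr_ge0 invr_le0 ltW.
Qed.

(** The number of dyadic scales between r and 1: if r > 0 then
r = 2^-(log2V r). *)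
Definition log2V r : R := - ln r / ln 2.

Lemma ln2_gt0 : 0 < ln 2 :> R. Proof. by rewrite ln_gt0// ltr1n. Qed.

Lemma lnE r : ln r = - (log2V r * ln 2).
Proof. by rewrite /log2V divfK ?opprK// gt_eqF// ln2_gt0. Qed.

Lemma inv_exp2E n : ((2 ^+ n)^-1 : R) = expR (- (n%:R * ln 2)).
Proof. by rewrite expRN expRM_natl lnK// posrE. Qed.

Lemma log2V_exp2 n : log2V (2 ^+ n)^-1 = n%:R.
Proof. by rewrite /log2V inv_exp2E expRK opprK mulfK// gt_eqF// ln2_gt0. Qed.

Lemma log2V_gt (K : R) : 0 <= K ->
  exists2 d, 0 < d & forall r, 0 < r < d -> 0 < r < 1 /\ K < log2V r.
Proof.
move=> K0; exists (expR (- (K * ln 2))); first exact: expR_gt0.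
have l2 := ln2_gt0.
move=> r /andP[r0 rd]; rewrite r0/=; split.
  by rewrite (lt_le_trans rd)// -[leRHS]expR0 ler_expR oppr_le0 mulr_ge0// ltW.
rewrite ltr_pdivlMr// ltrNr -[ltRHS]expRK ltr_ln ?posrE ?expR_gt0//.
Qed.

Lemma dyadic_bracket r : 0 < r < 1 -> exists k,
  [/\ (2 ^+ k.+1)^-1 <= r, r <= (2 ^+ k)^-1 & k%:R <= log2V r < k%:R + 1].
Proof.
move=> /andP[r0 r1]; have l2 := ln2_gt0.
have L0 : 0 <= log2V r by rewrite divr_ge0 ?ltW// oppr_gt0 ln_lt0 ?r0.
have := truncn_itv L0; set k := Num.truncn _ => /andP[h1 h2].
have exp_r x : (expR (- (x * ln 2)) <= r) = (log2V r <= x) /\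
               (r <= expR (- (x * ln 2))) = (x <= log2V r).
  by rewrite -{1 3}(lnK r0) !ler_expR (lnE r) !lerN2 !ler_pM2r.
exists k; rewrite natr1 h1 h2 !inv_exp2E.
by rewrite (exp_r _).1 (exp_r _).2 h1 ltW.
Qed.

Lemma log_ratio_le_exp2 m A e r : 0 < r < 1 ->
  ((2 ^+ e)^-1%:E <= m r)%E -> e%:R <= A * log2V r ->
  (log_ratio m r <= A%:E)%E.
Proof.
move=> r01 h he; apply: log_ratio_le => //; apply: le_trans h.
by rewrite lee_fin inv_exp2E ler_expR (lnE r) mulrN mulrA lerN2 ler_pM2r// ln2_gt0.
Qed.

Lemma log_ratio_ge_exp2 m A (c e : nat) r : 0 < r < 1 ->
  (m r <= (2 ^+ c / 2 ^+ e)%:E)%E -> A * log2V r <= e%:R - c%:R ->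
  (A%:E <= log_ratio m r)%E.
Proof.
move=> r01 h he; apply: log_ratio_ge => //; apply: (le_trans h).
rewrite lee_fin inv_exp2E -[2 ^+ c]invrK inv_exp2E -expRN -expRD ler_expR opprK.
rewrite (lnE r) mulrN mulrA lerNr opprB -mulrBl.
by rewrite ler_pM2r ?ln2_gt0.
Qed.

(** For a monotone m, bounds at the radii 2^-k control all small radii:
replacing r by a neighbouring dyadic radius changes the exponent by an
additive constant, which the division by the logarithm of r makes negligible. *)
Lemma limf_esup_le_dyadic m (e : nat -> nat) D C : 0 <= D -> 0 <= C ->
  {homo m : x y / x <= y >-> (x <= y)%E} ->
  (forall k, ((2 ^+ e k)^-1%:E <= m ((2 ^+ k)^-1)%R)%E /\
             (e k)%:R <= D * k%:R + C) ->
  (limf_esup (log_ratio m) 0^'+ <= D%:E)%E.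
Proof.
move=> D0 C0 mm h; apply: limf_esup_le => eps eps0.
have [d d0 hd] : exists2 d, 0 < d &
    forall r, 0 < r < d -> 0 < r < 1 /\ (D + C) / eps < log2V r.
  by apply: log2V_gt; rewrite divr_ge0 ?addr_ge0// ltW.
exists d => // r /hd[r01]; rewrite ltr_pdivrMr// => hL.
have [k [rk _ /andP[kL Lk]]] := dyadic_bracket r01.
have [mk ek] := h k.+1.
apply: (@log_ratio_le_exp2 _ _ (e k.+1)) => //; first exact: le_trans (mm _ _ rk).
apply: le_trans ek _; rewrite -natr1; nra.
Qed.

Lemma limf_einf_ge_dyadic m (e : nat -> nat) (c : nat) D C : 0 <= D -> 0 <= C ->
  {homo m : x y / x <= y >-> (x <= y)%E} ->
  (forall k, (m ((2 ^+ k)^-1)%R <= (2 ^+ c / 2 ^+ e k)%:E)%E /\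
             D * k%:R - C <= (e k)%:R) ->
  (D%:E <= limf_einf (log_ratio m) 0^'+)%E.
Proof.
move=> D0 C0 mm h; apply: limf_einf_ge => eps eps0.
have [d d0 hd] : exists2 d, 0 < d &
    forall r, 0 < r < d -> 0 < r < 1 /\ (D + C + c%:R) / eps < log2V r.
  by apply: log2V_gt; rewrite divr_ge0 ?addr_ge0// ltW.
exists d => // r /hd[r01]; rewrite ltr_pdivrMr// => hL.
have [k [_ rk /andP[kL Lk]]] := dyadic_bracket r01.
have [mk ek] := h k.
apply: (@log_ratio_ge_exp2 _ _ c (e k)) => //; first exact: le_trans (mm _ _ rk) mk.
nra.
Qed.

Lemma exp2V_small (d K : R) : 0 < d -> exists M, forall k, (M <= k)%N ->
  [/\ 0 < ((2 ^+ k)^-1 : R) < 1, (2 ^+ k)^-1 < d & K < k%:R].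
Proof.
move=> d0; have l2 := ln2_gt0.
exists (Num.truncn (Num.max K (Num.max 0 (log2V d)))).+1 => k Mk.
have : Num.max K (Num.max 0 (log2V d)) < k%:R.
  by apply: lt_le_trans (truncnS_gt _) _; rewrite ler_nat.
rewrite !gt_max => /and3P[Kk k0 dk]; rewrite Kk invr_gt0 exprn_gt0//; split => //.
  by rewrite inv_exp2E expR_lt1 oppr_lt0 mulr_gt0.
by rewrite inv_exp2E -[ltRHS]lnK ?posrE// ltr_expR (lnE d) ltrN2 ltr_pM2r.
Qed.

(** To bound an upper limit from below it is enough to use infinitely many
dyadic radii, hence no monotonicity. *)
Lemma limf_esup_ge_dyadic m (c : nat) D C :
  (forall M, exists k e : nat, [/\ (M <= k)%N,
     (m ((2 ^+ k)^-1)%R <= (2 ^+ c / 2 ^+ e)%:E)%E & D * k%:R - C <= e%:R]) ->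
  (D%:E <= limf_esup (log_ratio m) 0^'+)%E.
Proof.
move=> h; apply: limf_esup_ge => eps d eps0 d0.
have [M hM] := exp2V_small ((C + c%:R) / eps) d0.
have [k [e [/hM[k01 kd]]]] := h M; rewrite ltr_pdivrMr// => kK mk ek.
exists (2 ^+ k)^-1; first by case/andP: k01 => ->.
apply: (@log_ratio_ge_exp2 _ _ c e) => //; rewrite log2V_exp2; lra.
Qed.

Lemma limf_einf_le_dyadic m D C :
  (forall M, exists k e : nat, [/\ (M <= k)%N,
     ((2 ^+ e)^-1%:E <= m ((2 ^+ k)^-1)%R)%E & e%:R <= D * k%:R + C]) ->
  (limf_einf (log_ratio m) 0^'+ <= D%:E)%E.
Proof.
move=> h; apply: limf_einf_le => eps d eps0 d0.
have [M hM] := exp2V_small (C / eps) d0.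
have [k [e [/hM[k01 kd]]]] := h M; rewrite ltr_pdivrMr// => kK mk ek.
exists (2 ^+ k)^-1; first by case/andP: k01 => ->.
apply: (@log_ratio_le_exp2 _ _ e) => //; rewrite log2V_exp2; lra.
Qed.

End LogRatio.

Section Dyadic.
Context {R : realType}.
Implicit Types k m n : nat.

Lemma inv2S k : (2 ^+ k)^-1 = 2 * (2 ^+ k.+1)^-1 :> R.
Proof. by rewrite exprS invfM mulrA divff ?mul1r. Qed.

Lemma exp2V_gt0 k : 0 < (2 ^+ k)^-1 :> R.
Proof. by rewrite invr_gt0 exprn_gt0. Qed.

Lemma exp2V_le m n : (m <= n)%N -> (2 ^+ n)^-1 <= (2 ^+ m)^-1 :> R.
Proof. by move=> mn; rewrite lef_pV2 ?posrE ?exprn_gt0// ler_eXn2l// ltr1n. Qed.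

End Dyadic.

(** * A schedule of free levels with oscillating density *)

Section Schedule.
Context {R : realType}.
Variables p q : R.
Hypotheses (p0 : 0 < p) (pq : p < q) (q1 : q < 1).

(** The state at level k is made of a flag, which tells whether the previous
level is free, and of the number of free levels below k. Passing from one mode to the other
at two different densities, q upwards and p downwards, is what makes the
density oscillate. *)
Fixpoint schedule (k : nat) : bool * nat :=
  if k is k'.+1 then
    let: (b, d) := schedule k' in
    let b' := if b then d%:R < q * k'%:R else d%:R <= p * k'%:R in
    (b', (d + b')%N)
  else (true, 0%N).

Definition free_level k : bool := (schedule k.+1).1.
Definition num_free k : nat := (schedule k).2.

Lemma num_free0 : num_free 0 = 0%N. Proof. by []. Qed.

Lemma num_freeS k : num_free k.+1 = (num_free k + free_level k)%N.
Proof. by rewrite /num_free /free_level /=; case: (schedule k). Qed.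

Lemma free_levelS k : free_level k.+1 =
  if free_level k then (num_free k.+1)%:R < q * k.+1%:R
  else (num_free k.+1)%:R <= p * k.+1%:R.
Proof. by rewrite /free_level /num_free /=; case: (schedule k) => b d. Qed.

Lemma free_level0 : free_level 0 = false.
Proof. by rewrite /free_level/= mulr0 ltxx. Qed.

Lemma free_level_le k : free_level k -> (num_free k)%:R <= q * k%:R.
Proof.
case: k => [|k]; first by rewrite free_level0.
rewrite free_levelS; case: ifP => _; first exact: ltW.
by move=> /le_trans; apply; rewrite ler_wpM2r// ltW.
Qed.

Lemma num_free_ge_not_free k : ~~ free_level k -> p * k%:R <= (num_free k)%:R.
Proof.
case: k => [|k]; first by rewrite mulr0.
rewrite free_levelS; case: ifP => _; rewrite -?leNgt -?ltNge; last exact: ltW.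
by apply: le_trans; rewrite ler_wpM2r// ltW.
Qed.

(** The density passes q by at most the one level at which this is noticed. *)
Lemma num_free_le k : (num_free k)%:R <= q * k%:R + 1.
Proof.
elim: k => [|k IH]; first by rewrite num_free0 mulr0 add0r ler01.
have q0 : 0 < q by exact: lt_trans p0 pq.
rewrite num_freeS; have := @free_level_le k; case: (free_level k) => /= h.
  have {}h := h isT; rewrite addn1 -!natr1; nra.
rewrite addn0 -natr1; nra.
Qed.

Lemma num_free_ge k : p * k%:R - 1 <= (num_free k)%:R.
Proof.
elim: k => [|k IH]; first by rewrite mulr0 add0r lerN10.
have p1 : p < 1 by exact: lt_trans q1.
have E : p * (k%:R + 1) = p * k%:R + p by rewrite mulrDr mulr1.
rewrite num_freeS; have := @num_free_ge_not_free k; case: (free_level k) => /= h.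
  by rewrite addn1 -!natr1; lra.
by have {}h := h isT; rewrite addn0 -natr1; lra.
Qed.

Lemma num_free_const k n : (forall i, (k <= i < n)%N -> ~~ free_level i) -> (k <= n)%N ->
  num_free n = num_free k.
Proof.
elim: n => [|n IH] h; first by rewrite leqn0 => /eqP ->.
rewrite leq_eqVlt => /predU1P[->//|]; rewrite ltnS => kn.
have /negbTE fn : ~~ free_level n by apply: h; rewrite kn ltnS leqnn.
rewrite num_freeS fn addn0; apply: IH => // i /andP[ki ni].
by apply: h; rewrite ki ltnS ltnW.
Qed.

(** Without a free level the count would stay constant, against the lower
bound p k - 1. *)
Lemma next_free k : exists j, [/\ (k <= j)%N, free_level j,
  forall i, (k <= i < j)%N -> ~~ free_level i & num_free j = num_free k].
Proof.
have ex : exists j, (k <= j)%N && free_level j.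
  apply: contrapT => no.
  have nof i : (k <= i)%N -> ~~ free_level i.
    by move=> ki; apply/negP => fi; apply: no; exists i; rewrite ki.
  pose n := (k + (Num.truncn (((num_free k)%:R + 1) / p)).+1)%N.
  have := num_free_ge n.
  rewrite (@num_free_const k n) ?leq_addr//; last by move=> i /andP[/nof].
  have : ((num_free k)%:R + 1) / p < n%:R.
    by apply: lt_le_trans (truncnS_gt _) _; rewrite ler_nat leq_addl.
  rewrite ltr_pdivrMr//; lra.
have [j /andP[kj fj] jmin] := ex_minnP ex.
have nof i : (k <= i < j)%N -> ~~ free_level i.
  move=> /andP[ki ij]; apply/negP => fi.
  by have := jmin i; rewrite ki fi => /(_ isT); rewrite leqNgt ij.
by exists j; split => //; exact: num_free_const.
Qed.

(** If j > k then j - 1 is not free, so the density is still at least p there;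
since d k <= q k + 1, this bounds j. *)
Lemma next_free_le k : exists j, [/\ (k <= j)%N, free_level j, num_free j = num_free k &
  j%:R <= q / p * k%:R + p^-1 + 1].
Proof.
have [j [kj fj nof jk]] := next_free k; exists j; split => //.
have k0 : 0 <= k%:R :> R by [].
have qp : 1 <= q / p by rewrite ler_pdivlMr// mul1r ltW.
have ip : 0 < p^-1 by rewrite invr_gt0.
move: kj; rewrite leq_eqVlt => /predU1P[<-|kj]; first nra.
case: j => // j in fj nof jk kj *; rewrite ltnS in kj.
have fj' : ~~ free_level j by apply: nof; rewrite kj ltnS leqnn.
have := num_free_ge_not_free fj'.
have -> : num_free j = num_free k by rewrite -jk num_freeS (negbTE fj') addn0.
have := num_free_le k => h1 h2.
have : p * j%:R <= q * k%:R + 1 by apply: le_trans h1.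
rewrite -ler_pdivlMl// mulrDr mulr1 mulrA (mulrC _ q) -natr1; lra.
Qed.

(** Along an endless run the density would tend to 1 > q. *)
Lemma not_free_often M : exists2 k, (M <= k)%N & ~~ free_level k.
Proof.
apply: contrapT => no.
have fr i : (M <= i)%N -> free_level i.
  by move=> Mi; apply: contrapT => /negP fi; apply: no; exists i.
have nf n : num_free (M + n) = (num_free M + n)%N.
  by elim: n => [|n IH]; rewrite ?addn0// addnS num_freeS IH fr ?leq_addr// addn1 addnS.
pose n := (Num.truncn ((q * M%:R + 1) / (1 - q))).+1.
have := num_free_le (M + n); rewrite nf !natrD.
have : (q * M%:R + 1) / (1 - q) < n%:R by exact: truncnS_gt.
rewrite ltr_pdivrMr ?subr_gt0//.
have : 0 <= (num_free M)%:R :> R by [].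
lra.
Qed.

(** The level k is the first one of a gap, where the density has just reached
q, and j is the first free level after it, where it has just fallen to p. The
gap has length at least (q / p - 1) k, which is at least 2 once k is large. *)
Lemma long_gap M : exists k j, [/\ (M <= k)%N, (k.+2 <= j)%N,
  num_free j = num_free k, q * k%:R <= (num_free k)%:R & (num_free k)%:R <= p * j%:R].
Proof.
(* beyond M1 the length (q / p - 1) k of a gap exceeds 2 *)
pose M1 := maxn M.+1 (Num.truncn (2 / (q / p - 1))).+1.
have [k1 [Mk1 fk1 _ _]] := next_free M1.
have [i ki fi] := not_free_often k1.
have ex : exists i, (k1 <= i)%N && ~~ free_level i by exists i; rewrite ki.
have [k /andP[k1k fk] kmin] := ex_minnP ex => {i ki fi ex}.
have Mk : (M1 <= k)%N by exact: leq_trans k1k.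
have [j [kj fj nof jk]] := next_free k.
have qk : q * k%:R <= (num_free k)%:R.
  case: k => [|k] in k1k fk kmin Mk kj nof jk *; first by rewrite mulr0.
  have fk' : free_level k.
    move: k1k; rewrite leq_eqVlt => /predU1P[k1E|]; first by rewrite k1E (negbTE fk) in fk1.
    rewrite ltnS => k1k; apply: contrapT => /negP fk'.
    by have := kmin k; rewrite k1k fk' ltnn => /(_ isT).
  by move: fk; rewrite free_levelS fk' -leNgt.
have pj : (num_free k)%:R <= p * j%:R.
  case: j => [|j] in kj fj nof jk *; first by rewrite free_level0 in fj.
  have kj' : (k <= j)%N.
    by move: kj; rewrite leq_eqVlt => /predU1P[kE|//]; rewrite kE fj in fk.
  move: fj; rewrite free_levelS (negbTE (nof j _)) ?jk//.
  by rewrite kj' ltnS leqnn.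
exists k, j; split => //; first by rewrite (leq_trans _ Mk)// leq_max leqnSn.
have qp : 0 < q / p - 1 by rewrite subr_gt0 ltr_pdivlMr// mul1r.
rewrite -(ler_nat R) -addn2 natrD.
have : q / p * k%:R <= j%:R.
  by rewrite mulrAC ler_pdivrMr// (le_trans qk)// mulrC.
have : 2 / (q / p - 1) <= k%:R.
  apply: ltW; apply: lt_le_trans (truncnS_gt _) _.
  by rewrite ler_nat (leq_trans _ Mk)// leq_maxr.
rewrite ler_pdivrMr// mulrBr mulr1 (mulrC k%:R); lra.
Qed.

End Schedule.

(** * Binary expansions with prescribed free levels *)

Lemma floor_double {R : realType} (x : R) :
  exists c : bool, Num.floor (2 * x) = 2 * Num.floor x + c%:Z.
Proof.
have /andP[h1 h2] := floor_itv x.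
rewrite intrD in h2.
have [h|h] := ltP (2 * x) (2 * (Num.floor x)%:~R + 1).
  exists false; apply: floor_def; rewrite !intrD !intrM/=; lra.
exists true; apply: floor_def; rewrite !intrD !intrM/=; lra.
Qed.

Lemma eq0_small {R : realType} (a c : R) n :
  (forall k, `|a| <= c / 2 ^+ (n + k)) -> a = 0.
Proof.
move=> h; apply: contrapT => /eqP a0.
have na : 0 < `|a| by rewrite normr_gt0.
have [k hk] : exists k, c / `|a| < 2 ^+ (n + k) :> R.
  exists (Num.truncn (c / `|a|)).+1; apply: lt_le_trans (truncnS_gt _) _.
  by rewrite -natrX ler_nat (leq_trans _ (ltnW (ltn_expl _ _)))// leq_addl.
have := h k; rewrite ltr_pdivrMr// mulrC in hk.
by rewrite ler_pdivlMr ?exprn_gt0// leNgt hk.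
Qed.

Section Expansion.
Context {R : realType}.
Variables (b : nat -> bool) (d : nat -> nat).
Hypotheses (d0 : d 0 = 0%N) (dS : forall k, d k.+1 = (d k + b k)%N).
Implicit Types (v : R) (k j n : nat).

(** The expansion truncated after k binary places, as the numerator of a
fraction with denominator 2^k. At a free level the next digit
is the first binary digit of v that has not been used yet, and at the other
levels it is 0. The integral part of v is kept, which makes the construction
invariant under integral translations and spares any restriction to the unit
interval. *)
Fixpoint numer k v : int :=
  if k is k'.+1 then
    2 * numer k' v +
    (if b k' then Num.floor (2 ^+ (d k').+1 * v) - 2 * Num.floor (2 ^+ d k' * v)
     else 0)
  else Num.floor v.

Lemma numerS k v : exists c : bool, [/\
  numer k.+1 v = 2 * numer k v + c%:Z,
  b k -> Num.floor (2 ^+ d k.+1 * v) = 2 * Num.floor (2 ^+ d k * v) + c%:Z &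
  ~~ b k -> c = false].
Proof.
rewrite /= dS; case: (b k) => /=; last by exists false.
have [c hc] := floor_double (2 ^+ d k * v).
exists c; rewrite addn1 exprS -mulrA hc addrAC subrr add0r; split => //.
Qed.

(** The digits written down to level k are exactly the d k first binary digits
of v, which is why the cells of the expansion are the dyadic intervals of
length 2^-(d k). *)
Lemma numer_eqP k v v' :
  numer k v = numer k v' <->
  Num.floor (2 ^+ d k * v) = Num.floor (2 ^+ d k * v').
Proof.
elim: k => [|k IH]; first by rewrite /= d0 !mul1r.
have [c [h1 h2 h3]] := numerS k v; have [c' [h1' h2' h3']] := numerS k v'.
rewrite h1 h1'; case bk : (b k) => //; last first.
  by rewrite h3 ?h3' ?bk// dS bk addn0; lia.
rewrite h2// h2'//; case: c c' {h1 h2 h3 h1' h2' h3'} => [] []/=; lia.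
Qed.

Lemma numer_shift_le k n v : 2 ^+ n * numer k v <= numer (n + k) v /\
  numer (n + k) v + 1 <= 2 ^+ n * (numer k v + 1).
Proof.
elim: n => [|n [IH1 IH2]]; first by rewrite !mul1r.
rewrite addSn !exprS -!mulrA.
by have [c [-> _ _]] := numerS (n + k) v; case: c => /=; lia.
Qed.

(** Inside a gap only zeros are written. *)
Lemma numer_gap k n v : d (n + k) = d k ->
  numer (n + k) v = 2 ^+ n * numer k v.
Proof.
have mono m : (d k <= d (m + k))%N.
  by elim: m => [|m IH]//; rewrite addSn dS (leq_trans IH)// leq_addr.
elim: n => [|n IH]; first by rewrite mul1r.
rewrite addSn dS => h; have := mono n => m.
have bn : ~~ b (n + k) by apply/negP => bn; move: h m; rewrite bn; lia.
have [c [-> _ /(_ bn)->]] := numerS (n + k) v.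
by rewrite IH ?addr0 ?exprS ?mulrA//; move: h; rewrite (negbTE bn); lia.
Qed.

Definition expansion v : R := sup (range (fun k => (numer k v)%:~R / 2 ^+ k)).

Lemma numer_frac_le k j v :
  (numer k v)%:~R / 2 ^+ k <= ((numer j v)%:~R + 1) / 2 ^+ j :> R.
Proof.
rewrite ler_pdivrMr ?exprn_gt0// mulrAC ler_pdivlMr ?exprn_gt0//.
have [kj|/ltnW jk] := leqP k j.
  have [h _] := numer_shift_le k (j - k) v; rewrite subnK// in h.
  have : ((2 ^+ (j - k) * numer k v)%:~R <= (numer j v)%:~R :> R) by rewrite ler_int.
  rewrite intrM rmorphXn/= => h'.
  have -> : 2 ^+ j = 2 ^+ (j - k) * 2 ^+ k :> R by rewrite -exprD subnK.
  have : 0 < 2 ^+ k :> R by rewrite exprn_gt0.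
  rewrite mulrA (mulrC _ (2 ^+ (j - k))); nra.
have [_ h] := numer_shift_le j (k - j) v; rewrite subnK// in h.
have : ((numer k v + 1)%:~R <= (2 ^+ (k - j) * (numer j v + 1))%:~R :> R) by rewrite ler_int.
rewrite intrM rmorphXn/= !intrD => h'.
have -> : 2 ^+ k = 2 ^+ (k - j) * 2 ^+ j :> R by rewrite -exprD subnK.
have : 0 < 2 ^+ j :> R by rewrite exprn_gt0.
rewrite mulrA (mulrC _ (2 ^+ (k - j))); nra.
Qed.

Lemma numer_le_expansion k v : (numer k v)%:~R <= 2 ^+ k * expansion v.
Proof.
rewrite mulrC -ler_pdivrMr ?exprn_gt0//; apply: ub_le_sup; last by exists k.
exists ((numer 0 v)%:~R + 1) => _ [j _ <-].
by rewrite (le_trans (numer_frac_le j 0 v))// divr1.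
Qed.

Lemma expansion_le_numer k v : 2 ^+ k * expansion v <= (numer k v)%:~R + 1.
Proof.
rewrite mulrC -ler_pdivlMr ?exprn_gt0//; apply: ge_sup; first by eexists; exists 0%N.
by move=> _ [j _ <-]; exact: numer_frac_le.
Qed.

(** Moving v by one unit of its binary digit of rank d j + 1, upwards or
downwards according to that digit, changes the digit written at level j and no
other one. *)
Lemma expansion_flip j v : b j ->
  exists v', `|expansion v' - expansion v| = (2 ^+ j.+1)^-1.
Proof.
move=> bj.
pose w := 2 ^+ d j * v.
have [c hc] := floor_double w.
(* s is the change of the digit c into 1 - c *)
pose s : int := if c then -1 else 1.
pose v' := v + s%:~R / 2 ^+ (d j).+1.
have fl n : (d j < n)%N -> Num.floor (2 ^+ n * v') =
    Num.floor (2 ^+ n * v) + s * 2 ^+ (n - (d j).+1).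
  move=> jn; rewrite /v' mulrDr.
  have -> : 2 ^+ n * (s%:~R / 2 ^+ (d j).+1) = (s * 2 ^+ (n - (d j).+1))%:~R :> R.
    rewrite intrM rmorphXn/= mulrCA; congr (_ * _).
    by rewrite -{1}(subnK jn) exprD mulfK// expf_neq0.
  by rewrite floorDrz// intrKfloor.
have flj : Num.floor (2 ^+ d j * v') = Num.floor (2 ^+ d j * v).
  have [c' hc'] := floor_double (2 ^+ d j * v').
  have := fl (d j).+1 (leqnn _).
  rewrite exprS -!mulrA hc' hc subnn mulr1 /s.
  by rewrite /w; case: (c) (c') => [] [] /=; lia.
have Yj : numer j v' = numer j v by apply/numer_eqP.
have Yi i : numer (i + j.+1) v' = numer (i + j.+1) v + s * 2 ^+ i.
  elim: i => [|i IH].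
    rewrite add0n /= bj Yj flj fl// subnn; lia.
  rewrite addSn /= IH (exprS (2 : int) i) (mulrCA s 2); case: ifP => // bi; last by lia.
  have dji : (d j < d (i + j.+1))%N.
    elim: (i) => [|i' IH']; first by rewrite add0n dS bj addn1.
    by rewrite addSn dS (leq_trans IH')// leq_addr.
  by rewrite !fl// 1?ltnW// subSS -(subnSK dji) (exprS (2 : int)) (mulrCA s 2); lia.
(* two expansions with the same later digits differ exactly by the flipped
   digit, as their truncations do up to 2^-k for every k *)
exists v'; have -> : expansion v' - expansion v = s%:~R / 2 ^+ j.+1.
  apply/eqP; rewrite -subr_eq0; apply/eqP; apply: (@eq0_small _ _ 1 j.+1) => i.
  rewrite ler_pdivlMr ?exprn_gt0// -[X in _ * X]gtr0_norm ?exprn_gt0// -normrM.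
  rewrite addnC mulrBl [X in _ - X](_ : _ = s%:~R * 2 ^+ i); last first.
    by rewrite exprD mulrCA divfK ?expf_neq0// mulrC.
  have h1 := numer_le_expansion (i + j.+1) v; have h2 := expansion_le_numer (i + j.+1) v.
  have h3 := numer_le_expansion (i + j.+1) v'; have h4 := expansion_le_numer (i + j.+1) v'.
  rewrite Yi intrD intrM rmorphXn/= in h3 h4.
  rewrite mulrBl (mulrC (expansion v')) (mulrC (expansion v)).
  by rewrite ler_norml; apply/andP; split; lra.
rewrite normrM normfV [X in _ / X]gtr0_norm ?exprn_gt0// /s.
by case: (c); rewrite ?normrN normr1 mul1r.
Qed.

Lemma numer_set k v0 : [set v | numer k v = numer k v0] =
  [set` `[(Num.floor (2 ^+ d k * v0))%:~R / 2 ^+ d k,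
          ((Num.floor (2 ^+ d k * v0))%:~R + 1) / 2 ^+ d k[] :> set R.
Proof.
have p2 : 0 < 2 ^+ d k :> R by rewrite exprn_gt0.
apply/seteqP; split=> v /=.
  move=> h; rewrite -((numer_eqP k v v0).1 h) in_itv/= ler_pdivrMr// ltr_pdivlMr// (mulrC v).
  by have := floor_itv (2 ^+ d k * v); rewrite intrD.
rewrite in_itv/= ler_pdivrMr// ltr_pdivlMr// (mulrC v) => h.
by apply/numer_eqP; apply: floor_def; rewrite intrD.
Qed.

Lemma lebesgue_numer k v0 :
  lebesgue_measure [set v | numer k v = numer k v0] = ((2 ^+ d k)^-1)%:E :> \bar R.
Proof.
rewrite numer_set lebesgue_measure_itv/= lte_fin ltr_pM2r ?invr_gt0 ?exprn_gt0// ltrDl ltr01.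
by rewrite -EFinB -mulrBl addrAC subrr add0r mul1r.
Qed.

Lemma measurable_numer k (c : int) : measurable [set v | numer k v = c].
Proof.
have [[v0 <-]|no] := pselect (exists v0, numer k v0 = c).
  by rewrite numer_set; exact: measurable_itv.
rewrite (_ : mkset _ = set0)//; apply/seteqP; split=> // v /= vc.
by apply: no; exists v.
Qed.

Lemma lebesgue_numer_le k (c : int) :
  (lebesgue_measure [set v | numer k v = c] <= ((2 ^+ d k)^-1)%:E :> \bar R)%E.
Proof.
have [[v0 <-]|no] := pselect (exists v0, numer k v0 = c).
  by rewrite lebesgue_numer.
rewrite (_ : mkset _ = set0) ?measure0 ?lee_fin ?invr_ge0 ?exprn_ge0//.
by apply/seteqP; split=> // v /= vc; apply: no; exists v.
Qed.

Lemma numer_range k (c : int) n :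
  [set v | c <= numer k v < c + n%:Z] =
  \big[setU/set0]_(i < n) [set v | numer k v = c + i%:Z].
Proof.
rewrite -(bigcup_mkord n (fun i => [set v | numer k v = c + i%:Z])).
apply/seteqP; split=> v /=.
  move=> /andP[h1 h2]; exists `|numer k v - c|%N => /=; lia.
by move=> [i /= iN ->]; lia.
Qed.

Lemma measurable_numer_range k (c : int) n :
  measurable [set v | c <= numer k v < c + n%:Z].
Proof.
by rewrite numer_range; apply: bigsetU_measurable => i _; exact: measurable_numer.
Qed.

Lemma lebesgue_numer_range k (c : int) n :
  (lebesgue_measure [set v | (c <= numer k v < c + n%:Z)%R]
     <= (n%:R / 2 ^+ d k)%:E :> \bar R)%E.
Proof.
rewrite numer_range.
apply: (le_trans (@Boole_inequality _ _ _ lebesgue_measure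
  (fun i => [set v | numer k v = c + i%:Z]) n _)) => [i _|].
  exact: measurable_numer.
apply: (@le_trans _ _ (\sum_(i < n) ((2 ^+ d k)^-1)%:E)%E).
  by apply: lee_sum => i _; exact: lebesgue_numer_le.
by rewrite sumEFin sumr_const card_ord mulr_natl.
Qed.

End Expansion.

Arguments numer : simpl never.

(** * Coordinates along and across a line *)

(** The identity of Lagrange, that is, the invariance of the Euclidean norm
under the rotation (a, b). *)
Lemma ortho_sum_sq {R : comRingType} (a b x y : R) : a ^+ 2 + b ^+ 2 = 1 ->
  (a * x + b * y) ^+ 2 + (a * y - b * x) ^+ 2 = x ^+ 2 + y ^+ 2.
Proof.
move=> ab; transitivity ((a ^+ 2 + b ^+ 2) * (x ^+ 2 + y ^+ 2)); first by ring.
by rewrite ab mul1r.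
Qed.

Lemma line_direction {R : realType} (l : {vspace 'rV[R]_2}) : \dim l = 1%N ->
  exists a b : R, a ^+ 2 + b ^+ 2 = 1 /\
    forall z, z \in l <-> exists c, z ord0 ord0 = c * a /\ z ord0 ord_max = c * b.
Proof.
move=> dl; pose v := vpick l.
have v0 : v != 0 by rewrite vpick0 -dimv_eq0 dl.
have lE : l = <[v]>%VS.
  by apply/esym/eqP; rewrite eqEdim dim_vline v0 dl andbT -memvE memv_pick.
pose x := v ord0 ord0; pose y := v ord0 ord_max.
have n0 : 0 < x ^+ 2 + y ^+ 2.
  rewrite lt_neqAle addr_ge0 ?sqr_ge0// andbT eq_sym paddr_eq0 ?sqr_ge0//.
  rewrite !sqrf_eq0; apply: contra v0 => /andP[/eqP x0 /eqP y0].
  apply/eqP/rowP => i; rewrite mxE; case: (unliftP ord0 i) => [j|] ->//.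
  by rewrite [j]ord1 -[RHS]y0; congr (v _ _); apply/val_inj.
set n := Num.sqrt (x ^+ 2 + y ^+ 2).
have ng : 0 < n by rewrite sqrtr_gt0.
have n2 : n ^+ 2 = x ^+ 2 + y ^+ 2 by rewrite sqr_sqrtr// ltW.
exists (x / n), (y / n); split.
  by rewrite !expr_div_n -mulrDl -n2 divff// expf_neq0// gt_eqF.
move=> z; rewrite lE; split.
  move=> /vlineP[k ->]; exists (k * n).
  by rewrite !mxE -!mulrA !(mulrCA n) divff ?gt_eqF// !mulr1.
move=> [c [z0 z1]]; apply/vlineP; exists (c / n); apply/rowP => i; rewrite !mxE.
case: (unliftP ord0 i) => [j|] ->; last by rewrite z0 [RHS]mulrAC mulrA.
have -> : lift ord0 j = ord_max :> 'I_2 by rewrite [j]ord1; apply/val_inj.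
by rewrite z1 [RHS]mulrAC mulrA.
Qed.

Section Frame.
Context {R : realType}.
Variables a b : R.
Hypothesis ab1 : a ^+ 2 + b ^+ 2 = 1.
Implicit Types (z w : 'rV[R]_2) (x y : R).

Definition along z : R := a * z ord0 ord0 + b * z ord0 ord_max.
Definition across z : R := a * z ord0 ord_max - b * z ord0 ord0.
Definition frame_point x y : 'rV[R]_2 :=
  \row_i (if i == ord0 then a * y - b * x else b * y + a * x).

Lemma along_frame_point x y : along (frame_point x y) = y.
Proof.
rewrite /along !mxE/=; transitivity ((a ^+ 2 + b ^+ 2) * y); first by ring.
by rewrite ab1 mul1r.
Qed.

Lemma across_frame_point x y : across (frame_point x y) = x.
Proof.
rewrite /across !mxE/=; transitivity ((a ^+ 2 + b ^+ 2) * x); first by ring.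
by rewrite ab1 mul1r.
Qed.

Lemma alongB z w : along (z - w) = along z - along w.
Proof. by rewrite /along !mxE; ring. Qed.

Lemma acrossB z w : across (z - w) = across z - across w.
Proof. by rewrite /across !mxE; ring. Qed.

Lemma scaled_coord_continuous (c : R) i :
  continuous (fun z : 'rV[R]_2 => c * z ord0 i).
Proof.
by move=> z; apply: continuousM; [exact: cst_continuous|exact: coord_continuous].
Qed.

Lemma along_continuous : continuous along.
Proof.
move=> z.
exact: (continuousD (@scaled_coord_continuous a ord0 z)
                    (@scaled_coord_continuous b ord_max z)).
Qed.

Lemma across_continuous : continuous across.
Proof.
move=> z.
exact: (continuousB (@scaled_coord_continuous a ord_max z)
                    (@scaled_coord_continuous b ord0 z)).
Qed.

Lemma sum_ord2 (F : 'I_2 -> R) : \sum_(i < 2) F i = F ord0 + F ord_max.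
Proof.
rewrite big_ord_recl big_ord1; congr (_ + F _); exact/val_inj.
Qed.

Lemma enormE z : enorm z = Num.sqrt (across z ^+ 2 + along z ^+ 2).
Proof.
by rewrite /enorm sum_ord2 [in RHS]addrC ortho_sum_sq.
Qed.

Lemma enorm_ge0 z : 0 <= enorm z. Proof. exact: sqrtr_ge0. Qed.

Lemma enorm_sq z : enorm z ^+ 2 = across z ^+ 2 + along z ^+ 2.
Proof. by rewrite enormE sqr_sqrtr// addr_ge0 ?sqr_ge0. Qed.

Lemma across_le_enorm z : `|across z| <= enorm z.
Proof. by rewrite enormE -sqrtr_sqr ler_wsqrtr// lerDl sqr_ge0. Qed.

Lemma along_le_enorm z : `|along z| <= enorm z.
Proof. by rewrite enormE -sqrtr_sqr ler_wsqrtr// lerDr sqr_ge0. Qed.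

Lemma enorm_le z : enorm z <= `|across z| + `|along z|.
Proof.
rewrite -[leRHS]ger0_norm ?addr_ge0// -[leRHS]sqrtr_sqr enormE ler_wsqrtr//.
by rewrite [leRHS]sqrrD !real_normK ?num_real// addrAC lerDl mulrn_wge0// mulr_ge0.
Qed.

Section Cone.
Variables (l : {vspace 'rV[R]_2}) (alpha : R).
Hypothesis hl : forall z, z \in l <->
  exists c, z ord0 ord0 = c * a /\ z ord0 ord_max = c * b.
Hypothesis halpha : 0 < alpha < 1.

Lemma edist_toE z : edist_to z [set` l] = `|across z|.
Proof.
apply/eqP; rewrite eq_le; apply/andP; split.
  apply: ge_inf; first by exists 0 => _ [w _ <-]; exact: enorm_ge0.
  exists (along z *: \row_i (if i == ord0 then a else b)).
    by apply/hl; exists (along z); rewrite !mxE.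
  set w := _ *: _.
  have [w1 w2] : along w = along z /\ across w = 0.
    rewrite /across {1}/along !mxE/=; split; last by ring.
    by transitivity ((a ^+ 2 + b ^+ 2) * along z); [ring|rewrite ab1 mul1r].
  by rewrite enormE acrossB alongB w1 w2 subrr subr0 expr0n addr0 sqrtr_sqr.
apply: lb_le_inf; first by exists (enorm (z - 0)), 0 => //; exact: mem0v.
move=> _ [w /hl[c [w1 w2]] <-].
have w0 : across w = 0 by rewrite /across w1 w2; ring.
by rewrite -[across z]subr0 -w0 -acrossB across_le_enorm.
Qed.

Lemma coneE z w : cone z l alpha w <-> `|across (w - z)| < alpha * enorm (w - z).
Proof. by rewrite /cone/= edist_toE. Qed.

(** The along coordinate is at most the norm. *)
Lemma cone_of_narrow z w :
  `|across (w - z)| < alpha * `|along (w - z)| -> cone z l alpha w.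
Proof.
move=> h; apply/coneE; apply: lt_le_trans h _; case/andP: halpha => a0 _.
by rewrite ler_pM2l// along_le_enorm.
Qed.

(** Squaring, x^2 < alpha^2 (x^2 + y^2) gives (1 - alpha^2) x^2 < y^2. *)
Lemma cone_sub_wide C z w : 0 <= C -> 1 <= C ^+ 2 * (1 - alpha ^+ 2) ->
  cone z l alpha w -> `|across (w - z)| <= C * `|along (w - z)|.
Proof.
move=> C0 hC /coneE; set x := across _; set y := along _ => h.
have [a0 a1] := andP halpha.
rewrite -ler_sqr ?nnegrE ?mulr_ge0// exprMn !real_normK ?num_real//.
have : `|x| ^+ 2 < (alpha * enorm (w - z)) ^+ 2.
  by rewrite ltr_sqr ?nnegrE// mulr_ge0 ?enorm_ge0// ltW.
rewrite exprMn enorm_sq real_normK ?num_real// -/x -/y.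
have : 0 <= x ^+ 2 by exact: sqr_ge0.
have : 0 <= y ^+ 2 by exact: sqr_ge0.
have : 0 <= C ^+ 2 by exact: sqr_ge0.
have : 0 < alpha ^+ 2 < 1 by rewrite exprn_gt0//= expr_lt1// ltW.
move: (x ^+ 2) (y ^+ 2) (C ^+ 2) (alpha ^+ 2) hC => X Y K A hC /andP[A0 A1] K0 Y0 X0 h1.
have : X * (1 - A) <= Y by nra.
nra.
Qed.

End Cone.
End Frame.

(** * Borel regular outer measures from images of measures *)

(** The outer measure is the infimum of the image measure over Borel
supersets. The infimum is attained by a countable intersection of almost
optimal ones, whence the regularity. The last two clauses allow estimates of
the masses by sets of parameters only; the lower one holds for arbitrary sets
because E is contained in the preimage of every Borel superset of A. *)
Lemma borel_regular_image {R : realType} d (T : measurableType d)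
    (m : {measure set T -> \bar R}) (f : T -> 'rV[R]_2) :
  (forall U, open U -> measurable (f @^-1` U)) ->
  exists mu : {outer_measure set 'rV[R]_2 -> \bar R}, [/\ borel_regular mu,
    forall A E, measurable E -> E `<=` f @^-1` A -> (m E <= mu A)%E &
    forall A E, borel A -> measurable E -> f @^-1` A `<=` E -> (mu A <= m E)%E].
Proof.
move=> fopen.
pose B := g_sigma_algebraType (@open 'rV[R]_2).
have mf : measurable_fun setT (f : T -> B).
  apply: (@measurability _ _ T B setT f (@open 'rV[R]_2)) => // _ [U oU <-].
  by rewrite setTI; exact: fopen.
pose P : {measure set B -> \bar R} :=
  measure_function_pushforward__canonical__measure_function_Measure m mf.
pose mu : {outer_measure set B -> \bar R} := (P^*)%mu.
have muB A : borel A -> mu A = m (f @^-1` A).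
  by move=> bA; rewrite /mu /= measurable_mu_extE.
have muBE A E : borel A -> measurable E -> f @^-1` A `<=` E -> (mu A <= m E)%E.
  move=> bA mE AE; rewrite muB//; apply: le_measure; rewrite ?inE//.
  by rewrite -[X in measurable X]setTI; exact: (mf measurableT).
have mum A E : measurable E -> E `<=` f @^-1` A -> (m E <= mu A)%E.
  move=> mE EA; apply: le_ereal_inf_tmp => _ [F [mF AF] <-].
  have mFc : measurable (\bigcup_k F k) by exact: bigcup_measurable.
  apply: (@le_trans _ _ (P (\bigcup_k F k))); last first.
    exact: measure_sigma_subadditive.
  apply: le_measure; rewrite ?inE//.
    by rewrite -[X in measurable X]setTI; exact: (mf measurableT).
  by move=> x /EA /AF.
exists mu; split => //; split.
  by move=> A bA; exact: (@caratheodory_measurable_mu_ext _ R B P A bA).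
move=> A.
have [muA|muA] := eqVneq (mu A) +oo%E.
  by exists setT; split => //; [exact: (@measurableT _ B)|
    apply/eqP; rewrite eq_le muA leey -muA le_outer_measure].
have Afin : mu A \is a fin_num.
  by rewrite ge0_fin_numE ?ltey// outer_measure_ge0.
have ex n : exists Bn : set B, [/\ measurable Bn, A `<=` Bn &
    (P Bn <= mu A + (n.+1%:R^-1)%:E)%E].
  have n0 : 0 < n.+1%:R^-1 :> R by rewrite invr_gt0.
  have [_ [F [mF AF] <-] hF] := lb_ereal_inf_adherent n0 Afin.
  exists (\bigcup_k F k); split => //; first exact: bigcup_measurable.
  apply: le_trans (ltW hF).
  by apply: measure_sigma_subadditive => //; exact: bigcup_measurable.
have [Bn hBn] := choice ex.
have mI : measurable (\bigcap_n Bn n) by apply: bigcap_measurable => // n _; have [] := hBn n.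
have AI : A `<=` \bigcap_n Bn n by move=> x Ax n _; have [_ + _] := hBn n; apply.
exists (\bigcap_n Bn n); split => //.
apply/eqP; rewrite eq_le; apply/andP; split; last exact: le_outer_measure.
apply/lee_addgt0Pr => e e0.
have [n ne] : exists n, n.+1%:R^-1 < e.
  exists (Num.truncn e^-1); rewrite invf_plt ?posrE//; exact: truncnS_gt.
apply: (@le_trans _ _ (mu A + (n.+1%:R^-1)%:E)%E); last first.
  by rewrite leeD2l// lee_fin ltW.
have [mBn _ hn] := hBn n.
apply: le_trans hn; rewrite /mu/= measurable_mu_extE//.
by apply: le_measure; rewrite ?inE// => x; apply.
Qed.

(** * The parametrization of the measure *)

Section BorelSets.
Context {R : realType}.

Lemma borel_continuous_le (g : 'rV[R]_2 -> R) r :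
  continuous g -> borel [set z | g z <= r].
Proof.
move=> cg; rewrite -[X in borel X]setCK.
apply: (@measurableC _ (g_sigma_algebraType (@open 'rV[R]_2))).
apply: sub_sigma_algebra; rewrite openC.
exact: (closed_comp (fun z _ => cg z) (closed_le (y := r))).
Qed.

Lemma borelI (A B : set 'rV[R]_2) : borel A -> borel B -> borel (A `&` B).
Proof. exact: (@measurableI _ (g_sigma_algebraType (@open 'rV[R]_2))). Qed.

Lemma coord_le_norm (z : 'rV[R]_2) i : `|z ord0 i| <= `|z|.
Proof.
rewrite [leRHS]mx_normrE.
by rewrite (le_bigmax _ (fun ij => `|z ij.1 ij.2|) (ord0, i)).
Qed.

End BorelSets.

Section Image.
Context {R : realType}.
Variables (a b : R) (fr : nat -> bool) (d : nat -> nat).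
Hypotheses (ab1 : a ^+ 2 + b ^+ 2 = 1).
Hypotheses (d0 : d 0 = 0%N) (dS : forall k, d k.+1 = (d k + fr k)%N).

Let f := @expansion R fr d.
Let Y := @numer R fr d.

Definition embed (w : R * R) : 'rV[R]_2 := frame_point a b w.1 (f w.2).

Notation area := (@lebesgue_measure R \x @lebesgue_measure R)%E.

Lemma direction_le1 : `|a| <= 1 /\ `|b| <= 1.
Proof.
split; rewrite -ler_sqr ?nnegrE// real_normK ?num_real// expr1n -ab1.
  by rewrite lerDl sqr_ge0.
by rewrite lerDr sqr_ge0.
Qed.

Lemma numer_close k v v' : Y k v = Y k v' -> `|f v - f v'| <= (2 ^+ k)^-1.
Proof.
move=> e; have p2 : 0 < 2 ^+ k :> R by rewrite exprn_gt0.
rewrite -[leRHS]mul1r ler_pdivlMr// -[X in _ * X]gtr0_norm// -normrM mulrC mulrBr.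
have := numer_le_expansion d0 dS k v; have := expansion_le_numer d0 dS k v.
have := numer_le_expansion d0 dS k v'; have := expansion_le_numer d0 dS k v'.
rewrite -/(Y k v) -/(Y k v') -/(f v) -/(f v') e => *.
by rewrite ler_norml; apply/andP; split; lra.
Qed.

(** The map may be discontinuous at dyadic parameters, but it varies by at most
2^-k in each coordinate on the products of dyadic intervals of level k; hence
the preimage of an open set is the union of the countably many such products
that it contains. *)
Lemma open_preimage_embed U : open U -> measurable (embed @^-1` U).
Proof.
move=> oU.
pose cell (i : nat * (int * int)) : set (R * R) :=
  [set u | (i.2.1)%:~R / 2 ^+ i.1 <= u < ((i.2.1)%:~R + 1) / 2 ^+ i.1] `*`
  [set v | Y i.1 v = i.2.2].
pose F i := if `[< cell i `<=` embed @^-1` U >] then cell i else set0.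
have -> : embed @^-1` U = \bigcup_i F i.
  apply/seteqP; split; last first.
    by move=> w [i _]; rewrite /F; case: asboolP => // h /h.
  move=> [u v] /= Uw.
  have [e /= e0 eU] : nbhs_ball (embed (u, v)) U.
    by apply/nbhs_ballP; exact: open_nbhs_nbhs.
  have e20 : 0 < e / 2 by rewrite divr_gt0.
  have [k /(_ k (leqnn _))[_ ke _]] := exp2V_small 0 e20.
  have p2 : 0 < 2 ^+ k :> R by rewrite exprn_gt0.
  exists (k, (Num.floor (2 ^+ k * u), Y k v)) => //.
  rewrite /F; case: asboolP => [_|].
    split => //=; rewrite ler_pdivrMr// ltr_pdivlMr// (mulrC u).
    by have := floor_itv (2 ^+ k * u); rewrite intrD.
  case => -[u' v'] [/= hu hv]; apply: eU.
  have hf := numer_close hv.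
  have hu' : `|u' - u| <= (2 ^+ k)^-1.
    rewrite -[leRHS]mul1r ler_pdivlMr// -[X in _ * X]gtr0_norm// -normrM mulrC mulrBr.
    move: hu; rewrite ler_pdivrMr// ltr_pdivlMr// (mulrC u') => /andP[h1 h2].
    have := floor_itv (2 ^+ k * u); rewrite intrD => /andP[h3 h4].
    rewrite ler_norml; apply/andP; split; lra.
  have [a1 b1] := direction_le1.
  have bd (x y : R) : `|x| <= 1 -> `|y| <= 1 ->
      `|x * (f v' - f v) + y * (u' - u)| < e.
    move=> x1 y1; apply: le_lt_trans (ler_normD _ _) _; rewrite !normrM.
    have : `|x| * `|f v' - f v| <= 1 * (2 ^+ k)^-1 by exact: ler_pM.
    have : `|y| * `|u' - u| <= 1 * (2 ^+ k)^-1 by exact: ler_pM.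
    lra.
  split => // i j; rewrite !mxE/= /ball/= distrC; case: ifP => _.
    rewrite (_ : _ - _ = a * (f v' - f v) + (- b) * (u' - u)); last by ring.
    by apply: bd; rewrite ?normrN.
  rewrite (_ : _ - _ = b * (f v' - f v) + a * (u' - u)); last by ring.
  exact: bd.
apply: countable_bigcupT_measurable => // i; rewrite /F; case: asboolP => // _.
apply: measurableX; last exact: measurable_numer.
rewrite (_ : mkset _ = [set` `[(i.2.1)%:~R / 2 ^+ i.1, ((i.2.1)%:~R + 1) / 2 ^+ i.1[]).
  exact: measurable_itv.
by apply/seteqP; split=> x /=; rewrite in_itv.
Qed.

Definition strip (x0 r : R) : set R := [set` `[x0 - r, x0 + r]].

Lemma measurable_strip x0 r : measurable (strip x0 r).
Proof. exact: measurable_itv. Qed.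

Lemma lebesgue_strip x0 r : 0 <= r -> lebesgue_measure (strip x0 r) = (2 * r)%:E.
Proof.
move=> r0; rewrite lebesgue_measure_itv/= lte_fin.
have -> : x0 - r < x0 + r = (0 < r) by apply/idP/idP; lra.
case: ltP => h; first by rewrite -EFinB; congr EFin; lra.
by congr EFin; lra.
Qed.

Lemma area_cell x0 r k v0 : 0 <= r ->
  area (strip x0 r `*` [set v | Y k v = Y k v0]) = (2 * r / 2 ^+ d k)%:E.
Proof.
move=> r0; rewrite product_measure1E; [|exact: measurable_strip|exact: measurable_numer].
by rewrite EFinM; congr (_ * _)%E; [exact: lebesgue_strip|exact: lebesgue_numer].
Qed.

Lemma area_band_le x0 r k c n : 0 <= r ->
  (area (strip x0 r `*` [set v | (c <= Y k v < c + n%:Z)%R])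
     <= (2 * r * (n%:R / 2 ^+ d k))%:E)%E.
Proof.
move=> r0; rewrite product_measure1E; [|exact: measurable_strip|exact: measurable_numer_range].
rewrite EFinM; apply: lee_pmul => //.
  by move/eqP: (lebesgue_strip x0 r0); rewrite eq_le => /andP[].
exact: lebesgue_numer_range.
Qed.

Lemma mem_strip x0 r u : strip x0 r u <-> `|u - x0| <= r.
Proof. by rewrite /strip/= in_itv/= ler_distl. Qed.

End Image.

(** * Masses of balls and of cones *)

Section Estimates.
Context {R : realType}.
Variables (a b : R) (fr : nat -> bool) (d : nat -> nat).
Hypotheses (ab1 : a ^+ 2 + b ^+ 2 = 1).
Hypotheses (d0 : d 0 = 0%N) (dS : forall k, d k.+1 = (d k + fr k)%N).

Notation f := (@expansion R fr d).
Notation Y := (@numer R fr d).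
Notation embed := (@embed R a b fr d).
Notation area := (@lebesgue_measure R \x @lebesgue_measure R)%E.
Notation across := (across a b).
Notation along := (along a b).

Variable mu : {outer_measure set 'rV[R]_2 -> \bar R}.
Hypothesis mu_ge : forall A E,
  measurable E -> E `<=` embed @^-1` A -> (area E <= mu A)%E.
Hypothesis mu_le : forall A E,
  borel A -> measurable E -> embed @^-1` A `<=` E -> (mu A <= area E)%E.

(** Points are allowed in the closure of the set of expansions, since the set
of the expansions themselves lacks some limit points; all the estimates below
have enough room for a small error in the along coordinate. *)
Definition in_support z := forall e, 0 < e -> exists v, `|along z - f v| < e.

Lemma along_embed w : along (embed w) = f w.2.
Proof. exact: along_frame_point. Qed.

Lemma across_embed w : across (embed w) = w.1.
Proof. exact: across_frame_point. Qed.

Lemma continuous_dist (g : 'rV[R]_2 -> R) x :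
  continuous g -> continuous (fun w => `|g w - x|).
Proof.
move=> cg w.
exact: (continuous_comp (continuousB (cg w) (@cst_continuous _ _ x w))
                        (@norm_continuous _ _ _)).
Qed.

Lemma borel_box z r1 r2 :
  borel [set w | `|across (w - z)| <= r1 /\ `|along (w - z)| <= r2].
Proof.
rewrite (_ : mkset _ = [set w | `|across w - across z| <= r1] `&`
                       [set w | `|along w - along z| <= r2]); last first.
  by apply/seteqP; split=> w /=; rewrite acrossB alongB.
apply: borelI; apply: borel_continuous_le; apply: continuous_dist.
  exact: across_continuous.
exact: along_continuous.
Qed.

(** An interval of half-length r2 meets at most 2 + 2^(k+1) r2 cells of
level k, each of them of mass 2^-(d k). *)
Lemma mu_box_le z r1 r2 k n : 0 <= r1 -> 2 + 2 * (2 ^+ k * r2) <= n%:R ->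
  (mu [set w | (`|across (w - z)| <= r1)%R /\ (`|along (w - z)| <= r2)%R]
    <= (2 * r1 * (n%:R / 2 ^+ d k))%:E)%E.
Proof.
move=> r10 hn; have p2 : 0 < 2 ^+ k :> R by rewrite exprn_gt0.
have /andP[h5 h6] := floor_itv (2 ^+ k * (along z - r2)).
move: h5 h6; set fl := Num.floor _ => h5 h6; pose c := fl - 1.
apply: (@le_trans _ _ (area (strip (across z) r1 `*`
  [set v | (c <= Y k v < c + n%:Z)%R]))); last exact: area_band_le.
apply: mu_le; [exact: borel_box| |].
  by apply: measurableX; [exact: measurable_strip|exact: measurable_numer_range].
move=> [u v] /=; rewrite acrossB alongB along_embed across_embed /= => -[hu hv].
split; first by rewrite /= mem_strip.
rewrite /=; have := numer_le_expansion d0 dS k v; have := expansion_le_numer d0 dS k v.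
move: hv; rewrite ler_distl => /andP[h1 h2] h3 h4.
have h7 : 2 ^+ k * (along z - r2) <= 2 ^+ k * f v by rewrite ler_pM2l.
have h8 : 2 ^+ k * f v <= 2 ^+ k * (along z + r2) by rewrite ler_pM2l.
rewrite mulrDr in h8; rewrite mulrBr in h7.
apply/andP; split.
  rewrite -(ler_int R) /c intrB lerBlDr; lra.
rewrite -(ltr_int R) intrD /c intrB; rewrite intrD mulrBr in h6.
have -> : n%:Z%:~R = n%:R :> R by [].
lra.
Qed.

Lemma mu_ball_le z k : (mu (eball z (2 ^+ k)^-1) <= (2 ^+ 3 / 2 ^+ (k + d k))%:E)%E.
Proof.
have p2 : 0 < 2 ^+ k :> R by rewrite exprn_gt0.
have ip : 0 <= (2 ^+ k)^-1 :> R by rewrite invr_ge0 ltW.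
apply: (@le_trans _ _ (mu [set w | (`|across (w - z)| <= (2 ^+ k)^-1)%R /\
    (`|along (w - z)| <= (2 ^+ k)^-1)%R])).
  apply: le_outer_measure => w /= h; split; apply: le_trans h.
    exact: across_le_enorm.
  exact: along_le_enorm.
apply: le_trans (mu_box_le (n := 4) (k := k) _ _ _) _ => //.
  by rewrite divff ?gt_eqF// mulr1 -natrD.
by rewrite lee_fin exprD invfM le_eqVlt; apply/orP; left; apply/eqP; ring.
Qed.

Lemma d_add_le k i : (d (i + k) <= i + d k)%N.
Proof.
elim: i => [|i IH]//; rewrite !addSn dS.
by have := leq_b1 (fr (i + k)); lia.
Qed.

(** Points that share k + 2 digits with a point close to z stay in the ball. *)
Lemma mu_ball_ge z k : in_support z ->
  ((2 ^+ (k + d k + 2))^-1%:E <= mu (eball z (2 ^+ k)^-1))%E.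
Proof.
move=> /(_ _ (exp2V_gt0 k.+2))[v0 hv0].
apply: (@le_trans _ _ (area (strip (across z) (2 ^+ k.+1)^-1 `*`
  [set v | Y k.+2 v = Y k.+2 v0]))).
  rewrite (area_cell d0 dS); last exact/ltW/exp2V_gt0.
  rewrite -inv2S lee_fin -invfM -exprD.
  by apply: exp2V_le; have := d_add_le k 2; rewrite !addSn add0n; lia.
apply: mu_ge; first by apply: measurableX; [exact: measurable_strip|exact: measurable_numer].
move=> [u v] [/= /mem_strip hu hv]; apply: le_trans (enorm_le ab1 _) _.
rewrite acrossB alongB along_embed across_embed /=.
have h := numer_close d0 dS hv.
have := ler_distD (f v0) (f v) (along z); rewrite (distrC (f v0)).
move: hv0 h hu; rewrite (inv2S k) (inv2S k.+1); lra.
Qed.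

(** The complement of the support is open, and no parameter is mapped
into it. *)
Lemma outer_ae_in_support (P : 'rV[R]_2 -> Prop) :
  (forall z, in_support z -> P z) -> outer_ae mu P.
Proof.
move=> hP; pose K := along @^-1` closure (range f).
apply/eqP; rewrite eq_le outer_measure_ge0 andbT.
apply: (@le_trans _ _ (mu (~` K))).
  apply: le_outer_measure => z /= nP Kz; apply: nP; apply: hP => e e0.
  have [_ [[v _ <-] zv]] := Kz _ (nbhsx_ballx (along z) e e0).
  by exists v.
rewrite -[leRHS](@measure0 _ _ _ area).
apply: mu_le => //.
  apply: sub_sigma_algebra; rewrite openC.
  exact: (closed_comp (fun z _ => @along_continuous R a b z) (@closed_closure _ _)).
move=> [u v] /= nK; apply: nK; rewrite /K/= along_frame_point//.
by apply: subset_closure; exists v.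
Qed.

Lemma mu_bounded_finite A : bounded_set A -> (mu A < +oo)%E.
Proof.
move=> [M0 [_ hM]].
pose M := `|M0| + 1; have M1 : M0 < M by rewrite /M (le_lt_trans (ler_norm _))// ltrDl.
have MM : 0 <= M by rewrite addr_ge0.
have [a1 b1] := direction_le1 ab1.
have bd (x y : R) z : A z -> `|x| <= 1 -> `|y| <= 1 -> forall i j,
    `|x * z ord0 i - y * z ord0 j| <= 2 * M.
  move=> /(hM M M1) zM x1 y1 i j.
  apply: le_trans (ler_normB _ _) _; rewrite !normrM.
  have : `|x| * `|z ord0 i| <= 1 * M.
    by apply: ler_pM => //; exact: le_trans (coord_le_norm _ _) zM.
  have : `|y| * `|z ord0 j| <= 1 * M.
    by apply: ler_pM => //; exact: le_trans (coord_le_norm _ _) zM.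
  lra.
apply: (@le_lt_trans _ _ (mu [set w | (`|across (w - 0)| <= 2 * M)%R /\
    (`|along (w - 0)| <= 2 * M)%R])).
  apply: le_outer_measure => z Az /=; rewrite subr0; split; first exact: bd.
  by rewrite /along -[b]opprK mulNr; apply: bd; rewrite ?normrN.
apply: le_lt_trans (mu_box_le _ (k := 0)
  (n := (Num.truncn (2 + 2 * (2 ^+ 0 * (2 * M)))).+1) _ _) (ltry _).
  by rewrite mulr_ge0.
exact/ltW/truncnS_gt.
Qed.

Section ConeEstimates.
Variables (l : {vspace 'rV[R]_2}) (alpha : R) (c : nat).
Hypothesis hl : forall z, z \in l <->
  exists c, z ord0 ord0 = c * a /\ z ord0 ord_max = c * b.
Hypothesis halpha : 0 < alpha < 1.
Hypothesis alpha_ge : (2 ^+ c)^-1 <= alpha.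

(** Flipping the digit at level j gives a point at along distance about
2^-(j+1) from z and at across distance 0. All the parameters that agree with it
down to level L = j + c + 5 are within 2^-L of it, and 2^-c <= alpha makes this
narrow enough for the cone. *)
Lemma mu_cone_ge z j : fr j -> in_support z ->
  ((2 ^+ (j + d j + (c + 5).*2))^-1%:E
     <= mu (eball z (2 ^+ j)^-1 `&` cone z l alpha))%E.
Proof.
move=> frj; pose L := (c + 5 + j)%N.
move=> /(_ _ (exp2V_gt0 L))[v0 hv0].
have [v1 hv1] := expansion_flip d0 dS v0 frj.
have p : 0 < (2 ^+ L)^-1 :> R := exp2V_gt0 L.
have jL : (2 ^+ j.+1)^-1 = 2 ^+ c * 16 * (2 ^+ L)^-1 :> R.
  rewrite /L (_ : c + 5 + j = c + 4 + j.+1)%N; last by lia.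
  rewrite exprD [2 ^+ (c + 4)]exprD; field.
  by rewrite !expf_neq0.
have c1 : 1 <= 2 ^+ c :> R by rewrite exprn_ege1// ler1n.
have ca : 1 <= alpha * 2 ^+ c by rewrite -ler_pdivrMr ?exprn_gt0// mul1r.
apply: (@le_trans _ _ (area (strip (across z) (2 ^+ L)^-1 `*` [set v | Y L v = Y L v1]))).
  rewrite (area_cell d0 dS) ?lee_fin; last exact: ltW.
  apply: (@le_trans _ _ ((2 ^+ L)^-1 / 2 ^+ d L)).
    rewrite -invfM -exprD; apply: exp2V_le.
    have := d_add_le j (c + 5); rewrite -/L {2}/L -addnn.
    by move: (d L) (d j) => dL dj; clear; lia.
  by rewrite ler_pM2r ?invr_gt0 ?exprn_gt0//; lra.
apply: mu_ge; first by apply: measurableX; [exact: measurable_strip|exact: measurable_numer].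
move=> [u v] [/= /mem_strip hu hv].
have h := numer_close d0 dS hv.
have up : `|f v - along z| <= (2 ^+ j.+1)^-1 + 2 * (2 ^+ L)^-1.
  have h1 := ler_distD (f v1) (f v) (along z).
  have h2 := ler_distD (f v0) (f v1) (along z).
  rewrite (distrC (f v0)) hv1 in h2; lra.
have lo : (2 ^+ j.+1)^-1 - 2 * (2 ^+ L)^-1 <= `|f v - along z|.
  have h1 := ler_distD (f v) (f v1) (f v0); have h2 := ler_distD (along z) (f v) (f v0).
  rewrite hv1 (distrC (f v1)) in h1; lra.
split.
  apply: le_trans (enorm_le ab1 _) _.
  rewrite acrossB alongB along_embed across_embed /=.
  have : 0 <= (2 ^+ c - 1) * (2 ^+ L)^-1 :> R by rewrite mulr_ge0 ?subr_ge0// ltW.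
  rewrite (inv2S j) jL in up *; lra.
apply: (cone_of_narrow ab1 hl halpha).
rewrite acrossB alongB along_embed across_embed /=.
apply: (@lt_le_trans _ _ (alpha * ((2 ^+ j.+1)^-1 - 2 * (2 ^+ L)^-1))); last first.
  by rewrite ler_pM2l//; case/andP: halpha.
rewrite jL; apply: le_lt_trans hu _.
have [a0 a1] := andP halpha.
set q := (2 ^+ L)^-1 in p *.
have -> : alpha * (2 ^+ c * 16 * q - 2 * q) =
    (alpha * 2 ^+ c) * (16 * q) - alpha * (2 * q) by ring.
nra.
Qed.

Hypothesis alpha_le : 1 <= (2 ^+ c) ^+ 2 * (1 - alpha ^+ 2).

Lemma borel_wedge z r C :
  borel [set w | `|along (w - z)| <= r /\ `|across (w - z)| <= C * `|along (w - z)|].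
Proof.
rewrite (_ : mkset _ = [set w | `|along w - along z| <= r] `&`
  [set w | `|across w - across z| - C * `|along w - along z| <= 0]); last first.
  by apply/seteqP; split=> w /=; rewrite acrossB alongB subr_le0.
have ca := @continuous_dist along (along z) (@along_continuous _ a b).
apply: borelI; apply: borel_continuous_le => // w.
apply: (continuousB (@continuous_dist across (across z) (@across_continuous _ a b) w)).
exact: (continuousM (@cst_continuous _ _ C w) (ca w)).
Qed.

(** In a gap from level k to level j = n + k, the digits at the levels k and
beyond vanish up to level j. Therefore two expansions either share their cell of
level j, or are at distance at least 2^-k - 2^-j; the radius 2^-(k+2)
excludes the latter. The cone then bounds the across coordinate as well. *)
Lemma mu_cone_le z k n : (2 <= n)%N -> d (n + k) = d k -> in_support z ->
  (mu (eball z (2 ^+ k.+2)^-1 `&` cone z l alpha)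
     <= (2 ^+ (c + 2) / 2 ^+ (n + k + d k))%:E)%E.
Proof.
move=> n2 dn; set j := (n + k)%N in dn *.
move=> /(_ _ (exp2V_gt0 j))[v0 hv0].
apply: (@le_trans _ _ (mu [set w | (`|along (w - z)| <= (2 ^+ k.+2)^-1)%R /\
    (`|across (w - z)| <= 2 ^+ c * `|along (w - z)|)%R])).
  apply: le_outer_measure => w [/= h1 h2]; split.
    exact: le_trans (along_le_enorm ab1 _) h1.
  exact: (cone_sub_wide ab1 hl halpha _ alpha_le h2).
have p : 0 < (2 ^+ j)^-1 :> R := exp2V_gt0 j.
have pc : 0 < 2 ^+ c :> R by rewrite exprn_gt0.
pose r := 2 ^+ c * (2 * (2 ^+ j)^-1) : R.
apply: (@le_trans _ _ (area (strip (across z) r `*` [set v | Y j v = Y j v0]))); last first.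
  rewrite (area_cell d0 dS) ?dn; last by rewrite /r !mulr_ge0// ltW.
  by rewrite lee_fin /r !exprD !invfM le_eqVlt; apply/orP; left; apply/eqP; ring.
apply: mu_le; first exact: borel_wedge.
  by apply: measurableX; [exact: measurable_strip|exact: measurable_numer].
move=> [u v] /=; rewrite acrossB alongB along_embed across_embed /= => -[hv hu].
have dvv : `|f v - f v0| <= (2 ^+ k.+2)^-1 + (2 ^+ j)^-1.
  have := ler_distD (along z) (f v) (f v0); lra.
(* the points of the support in the ball all lie in the cell of v0 *)
have ej : Y j v = Y j v0.
  have gap w : Y j w = 2 ^+ n * Y k w by exact: numer_gap.
  rewrite !gap; congr (_ * _).
  have p2 : 0 < 2 ^+ k :> R by rewrite exprn_gt0.
  have jk : (2 ^+ j)^-1 <= (2 ^+ k.+2)^-1 :> R.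
    by apply: exp2V_le; rewrite -addn2 addnC leq_add2r.
  have small w : (Y k w)%:~R * (2 ^+ k)^-1 <= f w <=
      (Y k w)%:~R * (2 ^+ k)^-1 + (2 ^+ j)^-1.
    have := numer_le_expansion d0 dS j w; have := expansion_le_numer d0 dS j w.
    rewrite gap intrM rmorphXn/= => h1 h2.
    have jE : 2 ^+ j = 2 ^+ n * 2 ^+ k :> R by rewrite -exprD.
    have pj : 0 < 2 ^+ j :> R by rewrite exprn_gt0.
    have -> : (Y k w)%:~R * (2 ^+ k)^-1 = 2 ^+ n * (Y k w)%:~R / 2 ^+ j :> R.
      by rewrite jE; field; rewrite !expf_neq0.
    rewrite ler_pdivrMr// -[X in _ <= _ + X]mul1r -mulrDl ler_pdivlMr//.
    by rewrite (mulrC (f w)); apply/andP; split; lra.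
  have q4 : (2 ^+ k)^-1 = 4 * (2 ^+ k.+2)^-1 :> R.
    by rewrite (inv2S k) (inv2S k.+1); ring.
  have far w w' : (Y k w < Y k w')%R ->
      f w + (2 ^+ k)^-1 <= f w' + (2 ^+ j)^-1.
    rewrite -lezD1 -(ler_int R) intrD -(ler_pM2r (exp2V_gt0 k)) mulrDl mul1r => h.
    by have /andP[_ s1] := small w; have /andP[s2 _] := small w'; lra.
  move: dvv; rewrite ler_norml => /andP[w1 w2].
  have q0 : 0 < (2 ^+ k)^-1 :> R := exp2V_gt0 k.
  case: (ltgtP (Y k v) (Y k v0)) => // /far h.
    by have : (2 ^+ k)^-1 < (2 ^+ k)^-1 :> R by [lra]; rewrite ltxx.
  by have : (2 ^+ k)^-1 < (2 ^+ k)^-1 :> R by [lra]; rewrite ltxx.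
split; first apply/mem_strip => /=.
  apply: le_trans hu _; rewrite /r ler_pM2l//.
  have := numer_close d0 dS ej; have := ler_distD (f v0) (f v) (along z).
  rewrite (distrC (f v0)); lra.
exact: ej.
Qed.

End ConeEstimates.
End Estimates.

(** * Local dimensions *)

Lemma aperture_bound {R : realType} (alpha : R) : 0 < alpha < 1 ->
  exists c, (2 ^+ c)^-1 <= alpha /\ 1 <= (2 ^+ c) ^+ 2 * (1 - alpha ^+ 2).
Proof.
move=> /andP[a0 a1].
have b0 : 0 < 1 - alpha ^+ 2 by rewrite subr_gt0 expr_lt1// ltW.
have [M hM] := exp2V_small 0 a0; have [N hN] := exp2V_small 0 b0.
exists (maxn M N); have [_ h1 _] := hM _ (leq_maxl M N).
have [_ h2 _] := hN _ (leq_maxr M N); split; first exact: ltW.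
have p2 : 1 <= 2 ^+ maxn M N :> R by rewrite exprn_ege1// ler1n.
have p0 : 0 < 2 ^+ maxn M N :> R by rewrite exprn_gt0.
move: h2; rewrite -[X in X < _]mul1r ltr_pdivrMr// mulrC => h2.
rewrite expr2 -mulrA; nra.
Qed.

Section Dimensions.
Context {R : realType}.
Variables (a b : R) (s t : R).
Hypotheses (ab1 : a ^+ 2 + b ^+ 2 = 1).
Hypotheses (h1s : 1 < s) (hst : s < t) (ht2 : t < 2).

Notation p := (s - 1).
Notation q := (t - 1).
Notation fr := (free_level p q).
Notation d := (num_free p q).
Notation f := (@expansion R fr d).
Notation area := (@lebesgue_measure R \x @lebesgue_measure R)%E.

Let p0 : 0 < p. Proof. by rewrite subr_gt0. Qed.
Let pq : p < q. Proof. by rewrite ltrD2r. Qed.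
Let q1 : q < 1. Proof. by rewrite ltrBlDr. Qed.
Let d0 : d 0 = 0%N. Proof. exact: num_free0. Qed.
Let dS k : d k.+1 = (d k + fr k)%N. Proof. exact: num_freeS. Qed.

Variable mu : {outer_measure set 'rV[R]_2 -> \bar R}.
Hypothesis mu_ge : forall A E,
  measurable E -> E `<=` embed a b fr d @^-1` A -> (area E <= mu A)%E.
Hypothesis mu_le : forall A E,
  borel A -> measurable E -> embed a b fr d @^-1` A `<=` E -> (mu A <= area E)%E.

Lemma ball_homo z : {homo (fun r => mu (eball z r)) : x y / x <= y >-> (x <= y)%E}.
Proof. by move=> x y xy; apply: le_outer_measure => w /le_trans; apply. Qed.

Lemma lower_dim_locE z : in_support a b fr d z -> lower_dim_loc mu z = s%:E.
Proof.
move=> sz; apply/eqP; rewrite eq_le; apply/andP; split.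
  apply: (limf_einf_le_dyadic (C := 2)) => M.
  have [k [j [Mk kj jk _ pj]]] := long_gap p0 pq q1 M.
  exists j, (j + d j + 2)%N; split; first by rewrite (leq_trans Mk)// ltnW// ltnW.
    exact: (mu_ball_ge ab1 d0 dS mu_ge).
  rewrite jk !natrD; lra.
apply: (limf_einf_ge_dyadic (e := fun k => (k + d k)%N) (c := 3) (C := 1)) => //.
- by rewrite ltW// (lt_trans _ h1s).
- exact: ball_homo.
move=> k; split; first exact: (mu_ball_le ab1 d0 dS mu_le).
have := num_free_ge pq q1 k; rewrite natrD; lra.
Qed.

Lemma upper_dim_locE z : in_support a b fr d z -> upper_dim_loc mu z = t%:E.
Proof.
move=> sz; apply/eqP; rewrite eq_le; apply/andP; split.
  apply: (limf_esup_le_dyadic (e := fun k => (k + d k + 2)%N) (C := 3)) => //.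
  - by rewrite ltW// (lt_trans _ (lt_trans h1s hst)).
  - exact: ball_homo.
  move=> k; split; first exact: (mu_ball_ge ab1 d0 dS mu_ge).
  have := num_free_le p0 pq k; rewrite !natrD; lra.
apply: (limf_esup_ge_dyadic (c := 3) (C := 0)) => M.
have [k [j [Mk kj jk qk _]]] := long_gap p0 pq q1 M.
exists k, (k + d k)%N; split => //; first exact: (mu_ball_le ab1 d0 dS mu_le).
rewrite natrD; lra.
Qed.

(** From above, level k is compared with the next free level j, and the cone
at radius 2^-j is used inside that at radius 2^-k; from below, the radii
2^-(k+2) are used for the beginnings k of long gaps. *)
Lemma upper_cone_dimE (l : {vspace 'rV[R]_2}) (alpha : R) z :
  (forall z, z \in l <->
    exists c, z ord0 ord0 = c * a /\ z ord0 ord_max = c * b) ->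
  0 < alpha < 1 -> in_support a b fr d z ->
  limf_esup (log_ratio (fun r => mu (eball z r `&` cone z l alpha))) 0^'+
    = (s * (q / p))%:E.
Proof.
move=> hl ha sz; have [c [c1 c2]] := aperture_bound ha.
have ip : 0 < p^-1 by rewrite invr_gt0.
have qp0 : 0 < q / p by rewrite divr_gt0// (lt_trans p0).
have DE : s * (q / p) = q / p + q.
  by field; rewrite gt_eqF.
apply/eqP; rewrite eq_le; apply/andP; split.
  have [j hj] := choice (next_free_le p0 pq q1).
  apply: (limf_esup_le_dyadic (e := fun k => (j k + d (j k) + (c + 5).*2)%N)
    (C := p^-1 + 2 + (c + 5).*2%:R)).
  - by rewrite DE addr_ge0 ?ltW// (lt_trans p0).
  - by rewrite !addr_ge0// ltW.
  - move=> x y xy; apply: le_outer_measure => w [/= /le_trans h1 h2].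
    by split => //; apply: h1.
  move=> k; have [kj fj dj jle] := hj k; split.
    apply: le_trans (mu_cone_ge ab1 d0 dS mu_ge hl ha c1 fj sz) _.
    apply: le_outer_measure => w [/= h1 h2]; split => //.
    exact: le_trans h1 (exp2V_le kj).
  have := num_free_le p0 pq k; rewrite !natrD dj DE; lra.
apply: (limf_esup_ge_dyadic (c := c + 2) (C := 2 * (s * (q / p)))) => M.
have [k [j [Mk kj jk qk pj]]] := long_gap p0 pq q1 M.
have jE : j = (j - k + k)%N by rewrite subnK// ltnW// ltnW.
exists k.+2, (j + d k)%N; split; first by rewrite (leq_trans Mk)// -addn2 leq_addr.
  rewrite {1}jE; apply: (mu_cone_le ab1 d0 dS mu_le hl ha c2 _ _ sz).
    by rewrite ltn_subRL addn1.
  by rewrite -jE.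
have : q / p * k%:R <= j%:R.
  by rewrite mulrAC ler_pdivrMr// (le_trans qk)// mulrC.
rewrite DE natrD -addn2 natrD; lra.
Qed.

End Dimensions.

Theorem proposition3p6 (R : realType) (l : {vspace 'rV[R]_2}) (alpha : R)
    (hl : \dim l = 1%N) (halpha : 0 < alpha < 1) (s t : R)
    (h1s : 1 < s) (hst : s < t) (ht2 : t < 2) :
  exists mu : {outer_measure set 'rV[R]_2 -> \bar R},
    measure_on_plane mu /\
    outer_ae mu (fun x =>
      [/\ lower_dim_loc mu x = s%:E,
          limf_esup
            (log_ratio (fun r => mu (eball x r `&` cone x l alpha))) 0^'+
            = (s * ((t - 1) / (s - 1)))%:E,
          s * ((t - 1) / (s - 1)) > t &
          upper_dim_loc mu x = t%:E]).
Proof.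
have [a [b [ab1 lab]]] := line_direction hl.
pose fr := free_level (s - 1) (t - 1); pose d := num_free (s - 1) (t - 1).
have d0 : d 0 = 0%N by exact: num_free0.
have dS k : d k.+1 = (d k + fr k)%N by exact: num_freeS.
have [mu [reg mu_ge mu_le]] := borel_regular_image
  (lebesgue_measure \x lebesgue_measure)%E (open_preimage_embed ab1 d0 dS).
exists mu; split.
  split => //; last exact: (mu_bounded_finite ab1 d0 dS mu_le).
  have pos : (0 < (2 * 1 / 2 ^+ d 0)%:E :> \bar R)%E.
    by rewrite lte_fin divr_gt0// ?exprn_gt0// mulr1.
  rewrite gt_eqF// (lt_le_trans pos)// -(area_cell d0 dS 0 0 0 ler01).
  apply: mu_ge => //.
  by apply: measurableX; [exact: measurable_strip|exact: measurable_numer].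
apply: (outer_ae_in_support ab1 mu_le) => z sz; split.
- exact: (lower_dim_locE ab1 h1s hst ht2 mu_ge mu_le).
- exact: (upper_cone_dimE ab1 h1s hst ht2 mu_ge mu_le).
- by rewrite mulrA ltr_pdivlMr ?subr_gt0//; lra.
- exact: (upper_dim_locE ab1 h1s hst ht2 mu_ge mu_le).
Qed.
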